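(* Let $p\in(0,2]$. There is an absolute constant $C_0>0$ such that, provided $k<n^{C_0}$, any one-pass turnstile streaming algorithm which outputs a set $S$ of size $k$ such that the distribution of $S$ has variation distance at most $\frac13$ from the distribution of a sample without replacement of size $k$ from the distribution $\mu=(\mu_1,\dots,\mu_n)$, where $\mu_i=\frac{|x_i|^p}{\|x\|_p^p}$, requires $\Omega(k\log^2 n)$ bits of memory.
   Context: In the turnstile streaming model, a vector $x\in\{-M,-M+1,\dots,M\}^n$ with $M=\mathrm{poly}(n)$, initially zero, is defined by a stream of signed integer updates to its coordinates; a one-pass (randomized) algorithm reads the updates once, in order, and then produces its output. The guarantee is required for every input stream. A sample without replacement of size $k$ from $\mu$ is obtained by drawing indices successively, each drawn with probability proportional to $\mu_i$ among the indices not yet drawn. *)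

(* Defs.v *)
From HB Require Import structures.
From mathcomp Require Import all_boot all_order all_algebra.
From mathcomp Require Import all_classical all_reals all_analysis.
Set Implicit Arguments.
Unset Strict Implicit.
Unset Printing Implicit Defensive.
Import Order.TTheory GRing.Theory Num.Theory.
Local Open Scope classical_set_scope.
Local Open Scope ring_scope.

Section Streams.
Variable n : nat.

(* The pair (i, d) stands for the update x_i <- x_i + d. *)
Definition update := ('I_n * int)%type.

Definition final_vector (sigma : seq update) (i : 'I_n) : int :=
  \sum_(u <- sigma | u.1 == i) u.2.

(* The vector belongs to {-M, ..., M}^n after every update, and not only at
   the end of the stream. *)
Definition turnstile (M : nat) (sigma : seq update) : Prop :=
  forall (t : nat) (i : 'I_n), `|final_vector (take t sigma) i| <= M%:Z.

End Streams.

(* A one-pass randomized algorithm with s bits of memory.  The seed w in T is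
   drawn once from a probability space and may be read at any time at no cost
   in memory.  The argument of type nat of [alg_step] is the position of the
   update in the stream: it lets the algorithm use a fresh part of the seed for
   each update.  Only the memory contents between two updates, and between the
   last update and the output, are counted. *)
Record stream_alg (d : measure_display) (T : measurableType d) (n s : nat) :=
  StreamAlg {
    alg_init : T -> s.-tuple bool;
    alg_step : T -> nat -> s.-tuple bool -> update n -> s.-tuple bool;
    alg_out : T -> s.-tuple bool -> {set 'I_n};
    alg_init_meas : forall b, measurable [set w | alg_init w = b];
    alg_step_meas : forall t b u b',
      measurable [set w | alg_step w t b u = b'];
    alg_out_meas : forall b S, measurable [set w | alg_out w b = S]
  }.

Section Run.
Context {d : measure_display} {T : measurableType d} {n s : nat}.
Variable A : stream_alg T n s.

Fixpoint alg_run (w : T) (t : nat) (b : s.-tuple bool) (sigma : seq (update n))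
  : s.-tuple bool :=
  if sigma is u :: sigma' then alg_run w t.+1 (alg_step A w t b u) sigma'
  else b.

Definition alg_output (w : T) (sigma : seq (update n)) : {set 'I_n} :=
  alg_out A w (alg_run w 0%N (alg_init A w) sigma).

Definition output_law {R : realType} (P : probability T R)
    (sigma : seq (update n)) (S : {set 'I_n}) : R :=
  fine (P [set w | alg_output w sigma = S]).

End Run.

Definition lpnorm {R : realType} (p : R) (n : nat) (x : 'I_n -> int) : R :=
  (\sum_i `|(x i)%:~R| `^ p) `^ p^-1.

Definition lp_law {R : realType} (p : R) (n : nat) (x : 'I_n -> int)
  (i : 'I_n) : R := `|(x i)%:~R| `^ p / lpnorm p x `^ p.

(* Law of the set of the first k indices drawn: the set is S after k'.+1 draws
   if, for some i in S, it was S :\ i after k' draws and i was drawn next.  If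
   mu has fewer than k indices of positive mass then the k draws cannot be made,
   and wor_law mu k is not a probability distribution. *)
Fixpoint wor_law {R : realType} {n : nat} (mu : 'I_n -> R) (k : nat)
    (S : {set 'I_n}) : R :=
  if k is k'.+1 then
    \sum_(i in S) wor_law mu k' (S :\ i)
                  * (mu i / \sum_(j | j \notin S :\ i) mu j)
  else (S == finset.set0)%:R.

Definition tv_dist {R : realType} {I : finType} (f g : I -> R) : R :=
  2^-1 * \sum_i `|f i - g i|.

(* Streams whose final vector has fewer than k nonzero coordinates are excluded:
   a sample without replacement of size k does not exist for them, so that
   nothing is asked of the algorithm. *)
Definition samples_wor {R : realType} {d : measure_display}
    {T : measurableType d} (P : probability T R) {n s : nat} (p : R)
    (M k : nat) (A : stream_alg T n s) : Prop :=
  forall sigma : seq (update n),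
    turnstile M sigma ->
    (k <= #|[pred i | final_vector sigma i != 0%R]|)%N ->
    (forall w, #|alg_output A w sigma| = k) /\
    tv_dist (output_law A P sigma)
            (wor_law (lp_law p (final_vector sigma)) k) <= 3^-1.

(* Main.v *)
Require Import Defs.
From HB Require Import structures.
From mathcomp Require Import all_boot all_order all_algebra.
From mathcomp Require Import all_classical all_reals all_analysis.
From mathcomp Require Import measurable_realfun zify lra.
Import Order.TTheory GRing.Theory Num.Theory.
Local Open Scope ring_scope.

(** The reduction is from augmented indexing.  Alice holds a word [z] of length
    [D = m * e], with [m] of order [k] and [e] of order [log n], over an alphabet
    of size [2 ^ e], and writes the letter [z p] into the sketch as a block of
    ones whose length is multiplied by 8 every [m] positions.  Bob knows
    [z p'] for [p' > p] and deletes those blocks.  The block of [p] is then a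
    fraction at least [7 / (8 * m)] of what is left, so an exact sample of size
    [k] meets it, and reveals [z p], with probability at least 7/8; the
    algorithm reveals it with probability more than 1/6.  Fix a seed for which
    more than a sixth of all pairs [(z, p)] are decoded.  For each content of
    the memory, decoding from right to left bounds the sum over [z] of
    [(2 ^ e) ^ (number of decoded letters)] by [(2 * 2 ^ e) ^ D]; comparing with
    the average number of decoded letters, there must be [2 ^ s] contents with
    [s] at least of order [D * e].  All coordinates of the stream vector stay in
    [{0, 1}], so neither the exponent nor the bound [M] plays a role. *)

(** * Sampling without replacement from a fixed law *)

Section WithoutReplacement.
Context {R : realType} {n : nat}.
Variable mu : 'I_n -> R.
Hypothesis mu_ge0 : forall i, 0 <= mu i.

Lemma wor_law_ge0 (k : nat) (S : {set 'I_n}) : 0 <= wor_law mu k S.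
Proof.
elim: k S => [|k IHk] S /=; first by rewrite ler0n.
by apply: sumr_ge0 => i _; rewrite mulr_ge0// divr_ge0// sumr_ge0.
Qed.

Lemma wor_law_support (k : nat) (S : {set 'I_n}) (i : 'I_n) :
  mu i = 0 -> i \in S -> wor_law mu k S = 0.
Proof.
move=> mui0; elim: k S => [|k IHk] S iS /=.
  by case: eqP iS => // ->; rewrite inE.
apply: big1 => j jS; have [->|ji] := eqVneq j i.
  by rewrite mui0 mul0r mulr0.
by rewrite IHk ?mul0r// !inE eq_sym ji.
Qed.

(* Each draw avoids [B] with conditional probability at most [1 - mu B], since
   removing indices outside [B] only increases the relative mass of [B]. *)
Lemma wor_law_avoid (B : {set 'I_n}) (k : nat) : \sum_i mu i <= 1 ->
  \sum_(S : {set 'I_n} | [disjoint S & B]) wor_law mu k S <=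
  (1 - \sum_(i in B) mu i) ^+ k.
Proof.
move=> mu_le1.
have muB_le1 : \sum_(i in B) mu i <= 1.
  by apply: le_trans mu_le1; rewrite [leRHS](bigID (mem B)) /= lerDl sumr_ge0.
elim: k => [|k IHk].
  rewrite expr0 (bigD1 finset.set0) /=; last by apply/pred0P => x; rewrite !inE.
  by rewrite eqxx big1 ?addr0// => S /andP[_ /negPf ->].
pose w (S : {set 'I_n}) i := wor_law mu k S * (mu i / \sum_(j | j \notin S) mu j).
(* A set with its last draw [i] is reindexed as the previous set with an index outside it; both must
   avoid [B]. *)
have -> : \sum_(S : {set 'I_n} | [disjoint S & B]) wor_law mu k.+1 S =
    \sum_(S : {set 'I_n} | [disjoint S & B])
      \sum_(i | (i \notin S) && (i \notin B)) w S i.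
  rewrite (exchange_big_dep predT) //= [RHS](exchange_big_dep predT) //=.
  apply: eq_bigr => i _.
  rewrite (reindex_onto (fun S => i |: S) (fun S => S :\ i)) /=; last first.
    by move=> S /andP[_ iS]; rewrite finset.setD1K.
  apply: eq_big => [S|S /andP[/andP[_ _] /eqP ->] //].
  have -> : [disjoint i |: S & B] = (i \notin B) && [disjoint S & B].
    by rewrite -disjointU1; apply: eq_disjoint => j; rewrite !inE.
  rewrite !inE eqxx /= andbT.
  case: (boolP (i \in S)) => iS /=; last by rewrite setU1K// eqxx andbT andbC.
  rewrite andbF; apply/negbTE; rewrite negb_and; apply/orP; right.
  by apply: contraTneq iS => <-; rewrite !inE eqxx.
rewrite exprSr.
apply: (@le_trans _ _ (\sum_(S : {set 'I_n} | [disjoint S & B])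
  wor_law mu k S * (1 - \sum_(i in B) mu i))); last first.
  by rewrite -mulr_suml ler_wpM2r// subr_ge0.
apply: ler_sum => S SB; rewrite /w -mulr_sumr ler_wpM2l ?wor_law_ge0//.
rewrite -mulr_suml; set r := \sum_(j | j \notin S) mu j.
have r_ge0 : 0 <= r by rewrite sumr_ge0.
have r_le1 : r <= 1.
  by apply: le_trans mu_le1; rewrite [leRHS](bigID (mem S)) /= lerDr sumr_ge0.
have rE : r = \sum_(i in B) mu i + \sum_(i | (i \notin S) && (i \notin B)) mu i.
  rewrite /r (bigID (mem B)) /=; congr (_ + _); apply: eq_bigl => i.
  case: (boolP (i \in B)) => iB; rewrite ?andbF// andbT.
  by move: SB; rewrite disjoint_sym => /disjointFr ->.
(* When no mass is left outside [S], division by zero makes the conditional weights vanish. *)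
have [r0|r_neq0] := eqVneq r 0; first by rewrite r0 invr0 mulr0 subr_ge0.
have r_gt0 : 0 < r by rewrite lt_neqAle eq_sym r_neq0.
have muB_ge0 : 0 <= \sum_(i in B) mu i by rewrite sumr_ge0.
(* After clearing [r], the claim is that the mass of [B] times [r] is at most the mass of [B], which
   follows from [r <= 1]. *)
rewrite ler_pdivrMr// mulrBl mul1r lerBrDr [leRHS]rE addrC lerD2r.
by rewrite ler_piMr.
Qed.

End WithoutReplacement.

(** * Counting correct predictions of letters *)

Section Counting.
Variables (A : finType) (a0 : A).

(* Each factor is at most [#|A| + (#|A| - 1)]: only one value of the letter at
   position [p] is predicted, given the letters that follow it. *)
Lemma sum_correct_predictions (D : nat) (g : nat -> seq A -> option A) :
  (\sum_(z : D.-tuple A)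
     #|A| ^ (\sum_(p < D) (g p (drop p.+1 z) == Some (nth a0 z p)))
   <= (2 * #|A|) ^ D)%N.
Proof.
elim: D g => [|D IHD] g.
  rewrite (eq_bigr (fun=> 1%N)) => [|z _]; last by rewrite big_ord0.
  by rewrite sum1_card card_tuple.
(* The first letter is split off: its prediction sees only the tail, and no other prediction sees
   it. *)
rewrite (reindex (fun az : A * D.-tuple A => [tuple of az.1 :: az.2])) /=; last first.
  exists (fun z : D.+1.-tuple A => (thead z, [tuple of behead z])) => [[a z] _|z _] /=.
    by congr pair; apply: val_inj.
  by rewrite -tuple_eta.
under eq_bigr => az _ do rewrite big_ord_recl /= expnD drop0.
rewrite -(pair_bigA _ (fun a (z : D.-tuple A) => #|A| ^ (g 0 z == Some a) *
  #|A| ^ (\sum_(p < D) (g p.+1 (drop p.+1 z) == Some (nth a0 z p)))))%N /=.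
rewrite exchange_big /= expnS.
apply: (@leq_trans (\sum_(z : D.-tuple A) (2 * #|A|) *
  #|A| ^ (\sum_(p < D) (g p.+1 (drop p.+1 z) == Some (nth a0 z p))))%N).
  apply: leq_sum => z _; rewrite -big_distrl /= leq_mul2r; apply/orP; right.
  apply: (@leq_trans (\sum_a (1 + (g 0 z == Some a) * #|A|))%N).
    by apply: leq_sum => a _; case: eqP => _ /=; rewrite ?expn1 ?expn0 ?mul1n ?leq_addl ?leq_addr.
  rewrite big_split /= sum1_card mul2n -addnn leq_add2l -big_distrl /=.
  rewrite -[leqRHS]mul1n leq_mul2r; apply/orP; right.
  case: (g 0%N z) => [a|]; last by rewrite big1.
  rewrite (bigD1 a) //= eqxx big1 => [|b]; first by rewrite addn0.
  by move/negPf=> ba; apply/eqP; rewrite eqb0; apply: contraFN ba => /eqP[->].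
rewrite -big_distrr /= leq_mul2l; apply/orP; right.
exact: (IHD (fun p => g p.+1)).
Qed.

End Counting.

(** * Fixing a seed by averaging *)

Section Averaging.
Local Open Scope ereal_scope.

(** If at most [c] of the events held at every seed, their expected number, which is the sum of
    their probabilities, would be at most [c]. *)
Lemma exists_gt_average (R : realType) (d : measure_display)
    (T : measurableType d) (P : probability T R) (X : finType)
    (E : X -> set T) (c : R) :
  (forall x, measurable (E x)) ->
  (c < \sum_x fine (P (E x)))%R -> exists w, (c < \sum_x \1_(E x) w)%R.
Proof.
move=> mE; apply: contraPP => /forallNP count_le.
apply/negP; rewrite -leNgt.
have -> : (\sum_x fine (P (E x)))%R = fine (\int[P]_w \sum_x (\1_(E x) w)%:E).
  rewrite ge0_integral_sum//; last first.
    by move=> x; apply/measurable_EFinP; exact: measurable_indic.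
  rewrite -sum_fine//; last first.
    by move=> x _; rewrite integral_indic// setIT fin_num_measure.
  by apply: eq_bigr => x _; rewrite integral_indic// setIT.
have int_le : \int[P]_w \sum_x (\1_(E x) w)%:E <= c%:E.
  have -> : c%:E = \int[P]_w (cst c%:E w).
    by rewrite integral_cst//= probability_setT mule1.
  apply: ge0_le_integral => //.
  - by move=> w _; rewrite sume_ge0// => x _; rewrite lee_fin.
  - apply: emeasurable_sum => x.
    by apply/measurable_EFinP; exact: measurable_indic.
  - move=> w _; rewrite sumEFin lee_fin leNgt; exact/negP.
have int_ge0 : 0 <= \int[P]_w \sum_x (\1_(E x) w)%:E.
  by apply: integral_ge0 => w _; rewrite sume_ge0// => x _; rewrite lee_fin.
by rewrite -lee_fin fineK// ge0_fin_numE// (le_lt_trans int_le)// ltry.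
Qed.

End Averaging.

(** * Measurability of runs and outputs *)

Section FiniteValued.
Context {d : measure_display} {T : measurableType d}.

(** Each step of the algorithm reads the seed again, so [Y] depends on [w] directly as well as
    through [X]; splitting along the finitely many values of [X] separates the two. *)
Lemma measurable_fiber_comp (F G : finType) (X : T -> F) (Y : T -> F -> G) :
  (forall v, measurable [set w | X w = v]%classic) ->
  (forall v g, measurable [set w | Y w v = g]%classic) ->
  forall g, measurable [set w | Y w (X w) = g]%classic.
Proof.
move=> mX mY g.
have -> : [set w | Y w (X w) = g]%classic =
    (\big[setU/set0]_(v : F) ([set w | X w = v] `&` [set w | Y w v = g]))%classic.
  apply/seteqP; split=> [w /= YXg|w].
    by rewrite (bigD1 (X w)) //=; left.
  by elim/big_ind : _ => //= [B C HB HC [/HB|/HC]//|v _ [/= -> ->]].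
by apply: bigsetU_measurable => v _; exact: measurableI.
Qed.

Lemma probability_fibers {R : realType} (P : probability T R) (F : finType)
    (X : T -> F) (Q : pred F) :
  (forall v, measurable [set w | X w = v]%classic) ->
  fine (P [set w | Q (X w)]%classic) =
  \sum_(v | Q v) fine (P [set w | X w = v]%classic).
Proof.
move=> mX; rewrite sum_fine; last by move=> v _; rewrite fin_num_measure.
congr fine.
have -> : [set w | Q (X w)]%classic =
    (\bigcup_(v in [set` Q]) [set w | X w = v])%classic.
  apply/seteqP; split=> [w /= QX|w /= [v Qv /= ->]//].
  by exists (X w).
rewrite measure_fin_bigcup//; last first.
  by move=> u v _ _ [w [/= <- <-]].
rewrite -(@bigfs _ _ _ _ (index_enum F) Q) ?index_enum_uniq// => v _.
by rewrite mem_index_enum.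
Qed.

Context {n s : nat}.
Variable A : stream_alg T n s.

Lemma measurable_alg_run t (b : T -> s.-tuple bool) (sigma : seq (update n)) :
  (forall b', measurable [set w | b w = b']%classic) ->
  forall b', measurable [set w | alg_run A w t (b w) sigma = b']%classic.
Proof.
elim: sigma t b => [|u sigma IH] t b mb //= b'.
apply: (IH _ (fun w => alg_step A w t (b w) u)).
apply: (measurable_fiber_comp _ _ b (fun w v => alg_step A w t v u)) => //.
by move=> v g; exact: alg_step_meas.
Qed.

Lemma measurable_alg_output (sigma : seq (update n)) (S : {set 'I_n}) :
  measurable [set w | alg_output A w sigma = S]%classic.
Proof.
apply: (measurable_fiber_comp _ _ (fun w => alg_run A w 0 (alg_init A w) sigma)
  (fun w v => alg_out A w v)) => [|v g]; last exact: alg_out_meas.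
by apply: measurable_alg_run; exact: alg_init_meas.
Qed.

Lemma alg_run_cat w t b (sigma tau : seq (update n)) :
  alg_run A w t b (sigma ++ tau) =
  alg_run A w (t + size sigma) (alg_run A w t b sigma) tau.
Proof.
elim: sigma t b => [|u sigma IH] t b /=; first by rewrite addn0.
by rewrite IH addnS addSn.
Qed.

End FiniteValued.

(** * Insertions followed by deletions *)

Section SignedStream.
Variable n : nat.

Definition signed_stream (X Y : seq 'I_n) : seq (update n) :=
  [seq (x, 1) | x <- X] ++ [seq (y, - 1) | y <- Y].

Lemma final_vector_signed_stream (X Y : seq 'I_n) (i : 'I_n) :
  uniq X -> uniq Y ->
  final_vector (signed_stream X Y) i = (i \in X)%:Z - (i \in Y)%:Z.
Proof.
move=> uX uY; rewrite /final_vector big_cat !big_map /= -!count_uniq_mem//.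
congr (_ + _).
  by elim: X {uX} => [|x X IH] /=; rewrite ?big_nil// big_cons /= IH; case: eqP.
elim: Y {uY} => [|x Y IH] /=; first by rewrite big_nil.
by rewrite big_cons /= IH; case: eqP => //= _; lia.
Qed.

(** A prefix of such a stream is again one with duplicate-free lists, so every coordinate is a
    difference of two booleans. *)
Lemma turnstile_signed_stream (M : nat) (X Y : seq 'I_n) :
  (0 < M)%N -> uniq X -> uniq Y -> turnstile M (signed_stream X Y).
Proof.
move=> M_gt0 uX uY t i.
have [X' [Y' [uX' uY' ->]]] : exists X' Y' : seq 'I_n,
    [/\ uniq X', uniq Y' & take t (signed_stream X Y) = signed_stream X' Y'].
  exists (take t X), (take (t - size X) Y); split; try exact: take_uniq.
  rewrite /signed_stream take_cat size_map; case: ltnP => [tX|Xt].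
    rewrite (_ : t - size X = 0)%N; last by lia.
    by rewrite take0 cats0 map_take.
  by rewrite (take_oversize Xt) map_take.
by rewrite final_vector_signed_stream//; case: (_ \in _); case: (_ \in _) => /=; lia.
Qed.

End SignedStream.

(** Powers fix 0 and 1, so the law is uniform on the support; [0 < p] is what keeps the power of 0
    equal to 0. *)
Lemma lp_law_indicator (R : realType) (p : R) (n : nat) (x : 'I_n -> int)
    (U : {set 'I_n}) : 0 < p -> (forall i, x i = (i \in U)%:Z) ->
  forall i, lp_law p x i = (i \in U)%:R / #|U|%:R.
Proof.
move=> p_gt0 xU i; have p_neq0 : p != 0 by rewrite gt_eqF.
have xp j : `|(x j)%:~R| `^ p = (j \in U)%:R :> R.
  by rewrite xU; case: (j \in U); rewrite ?normr1 ?powR1// normr0 powR0.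
rewrite /lp_law /lpnorm -powRrM mulVf// powRr1; last first.
  by apply: sumr_ge0 => j _; rewrite powR_ge0.
rewrite xp; congr (_ / _); under eq_bigr do rewrite xp.
by rewrite -sum1_card natr_sum [RHS]big_mkcond; apply: eq_bigr => j _; case: ifP.
Qed.

(** The factor 2 pays for not assuming that [f] and [g] have the same total. *)
Lemma sum_le_tv_dist (R : realType) (I : finType) (f g : I -> R) (Q : pred I) :
  \sum_(i | Q i) f i <= \sum_(i | Q i) g i + 2 * tv_dist f g.
Proof.
rewrite /tv_dist mulrA divff ?pnatr_eq0// mul1r -lerBlDl -sumrB.
apply: (@le_trans _ _ (\sum_(i | Q i) `|f i - g i|)).
  by apply: ler_sum => i _; exact: ler_norm.
by rewrite [leRHS](bigID Q) /= lerDl sumr_ge0.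
Qed.

(** * The hard streams and their decoding *)

Section HardInstance.
Set Implicit Arguments.
Unset Strict Implicit.
Variables (D L n : nat) (A : finType) (f : 'I_D * 'I_L * A -> 'I_n).
Variable h : nat -> nat.
Hypothesis f_inj : injective f.
Hypothesis h_le : forall p, (p < D)%N -> (h p <= L)%N.

(* The letter [z p] is encoded by ones at [f (p, c, z p)], for [c < h p]; the
   copies [c >= h p] are never used. *)
Definition cells : seq ('I_D * 'I_L) := enum [pred x : 'I_D * 'I_L | x.2 < h x.1]%N.

Definition coordinate (z : nat -> A) (x : 'I_D * 'I_L) : 'I_n := f (x, z x.1).

Definition inserted (z : nat -> A) : seq 'I_n := [seq coordinate z x | x <- cells].

Definition deleted (z : nat -> A) (p : nat) : seq 'I_n :=
  [seq coordinate z x | x : 'I_D * 'I_L <- cells & (p < x.1)%N].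

Definition remaining (z : nat -> A) (p : nat) : {set 'I_n} :=
  [set coordinate z x | x : 'I_D * 'I_L & ((x.2 < h x.1) && (x.1 <= p))%N].

Definition block (z : nat -> A) (p : nat) : {set 'I_n} :=
  [set coordinate z x | x : 'I_D * 'I_L & ((x.2 < h x.1) && (x.1 == p :> nat))%N].

Definition decode_block (p : nat) (S : {set 'I_n}) : option A :=
  [pick a | [exists x : 'I_D * 'I_L, (x.1 == p :> nat) && (f (x, a) \in S)]].

Definition instance (z : nat -> A) (p : nat) : seq (update n) :=
  signed_stream _ (inserted z) (deleted z p).

Lemma mem_cells x : (x \in cells) = (x.2 < h x.1)%N.
Proof. by rewrite mem_enum. Qed.

Lemma coordinate_inj z : injective (coordinate z).
Proof. by move=> x y /f_inj[]. Qed.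

Lemma inserted_uniq z : uniq (inserted z).
Proof. by rewrite map_inj_uniq; [exact: enum_uniq|exact: coordinate_inj]. Qed.

Lemma deleted_uniq z p : uniq (deleted z p).
Proof.
rewrite map_inj_uniq; last exact: coordinate_inj.
by rewrite filter_uniq ?enum_uniq.
Qed.

Lemma final_vector_instance z p i :
  final_vector (instance z p) i = (i \in remaining z p)%:Z.
Proof.
rewrite final_vector_signed_stream ?inserted_uniq ?deleted_uniq//.
have [[x ->]|ni] := pselect (exists x, i = coordinate z x); last first.
  have -> : (i \in inserted z) = false.
    by apply/negP => /mapP[x _ ix]; apply: ni; exists x.
  have -> : (i \in deleted z p) = false.
    by apply/negP => /mapP[x _ ix]; apply: ni; exists x.
  have -> // : (i \in remaining z p) = false.
  by apply/negP => /imsetP[x _ ix]; apply: ni; exists x.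
rewrite !(mem_map (@coordinate_inj z)) (mem_imset _ _ (@coordinate_inj z)).
rewrite mem_cells mem_filter mem_cells !inE.
by case: (_ < h _)%N; case: leqP.
Qed.

Lemma card_cells_cond (Q : pred nat) :
  #|[pred x : 'I_D * 'I_L | ((x.2 < h x.1) && Q x.1)%N]| =
  (\sum_(i < D | Q i) h i)%N.
Proof.
rewrite -sum1_card big_mkcond /=.
rewrite -(pair_bigA _ (fun (i : 'I_D) (c : 'I_L) =>
  if [pred x : 'I_D * 'I_L | ((x.2 < h x.1) && Q x.1)%N] (i, c) then 1 else 0)%N) /=.
rewrite [RHS]big_mkcond /=; apply: eq_bigr => i _.
case: (Q i); last by rewrite big1// => c _; rewrite andbF.
rewrite -big_mkcond /= (eq_bigl (fun c : 'I_L => (c < h i)%N)) => [|c]; last by rewrite andbT.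
by rewrite -(big_ord_widen L (fun=> 1%N)) ?h_le// sum1_card card_ord.
Qed.

Lemma card_remaining z p : (p < D)%N -> #|remaining z p| = (\sum_(i < p.+1) h i)%N.
Proof.
move=> pD; rewrite (card_imset _ (@coordinate_inj z)) (big_ord_widen D)//.
rewrite -(card_cells_cond (fun i => i < p.+1)%N).
by apply: eq_card => x; rewrite !inE.
Qed.

Lemma card_block z p : (p < D)%N -> #|block z p| = h p.
Proof.
move=> pD; rewrite (card_imset _ (@coordinate_inj z)).
rewrite (eq_card (B := [pred x : 'I_D * 'I_L | ((x.2 < h x.1) && (x.1 == p :> nat))%N])).
  by rewrite (card_cells_cond (fun i => i == p)) (big_pred1 (Ordinal pD)).
by move=> x; rewrite !inE.
Qed.

Lemma block_sub z p : block z p \subset remaining z p.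
Proof.
apply: imsetS; apply/fintype.subsetP => x; rewrite !inE => /andP[-> /eqP ->] /=.
by rewrite leqnn.
Qed.

(** As [f] is injective, a sampled index determines its position and letter; at position [p], only
    the letter [z p] occurs in [remaining z p]. *)
Lemma decodeP z p (S : {set 'I_n}) : S \subset remaining z p ->
  ~~ [disjoint S & block z p] -> decode_block p S = Some (z p).
Proof.
move=> Ssub /pred0Pn[y /andP[/= yS /imsetP[x]]].
rewrite !inE => /andP[_ /eqP xp] yx; rewrite /decode_block; case: pickP => [a|none].
  case/existsP => x' /andP[/eqP x'p /(fintype.subsetP Ssub)/imsetP[x'' _]].
  by move/f_inj => [<- ->]; rewrite x'p.
move/negbT: (none (z p)) => /existsPn/(_ x).
by rewrite xp eqxx /= -xp -/(coordinate z x) -yx yS.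
Qed.

Lemma decode_success (R : realType) (d : measure_display)
    (T : measurableType d) (P : probability T R) (q : R) (M k s : nat)
    (B : stream_alg T n s) (z : nat -> A) (p : nat) :
  0 < q -> (0 < M)%N -> samples_wor P q M k B ->
  (p < D)%N -> (k <= \sum_(i < p.+1) h i)%N -> (0 < k)%N ->
  (1 - (h p)%:R / (\sum_(i < p.+1) h i)%:R) ^+ k <= 8^-1 :> R ->
  6^-1 < fine (P [set w | decode_block p (alg_output B w (instance z p)) == Some (z p)]%classic).
Proof.
move=> q_gt0 M_gt0 BP pD kN k_gt0 miss.
set sigma := instance z p.
have [|| _] := BP sigma.
- by apply: turnstile_signed_stream; rewrite ?inserted_uniq ?deleted_uniq.
- rewrite (leq_trans kN)// -(card_remaining z)// subset_leq_card//.
  apply/fintype.subsetP => i iU; rewrite inE /sigma final_vector_instance iU//.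
have muE := @lp_law_indicator R q n _ _ q_gt0 (final_vector_instance z p).
set mu := lp_law q _ in muE *.
set N := (\sum_(i < p.+1) h i)%N in kN miss *.
have cardU := card_remaining z pD; rewrite -/N in cardU.
have N_gt0 : (0 : R) < N%:R by rewrite ltr0n (leq_trans k_gt0).
have mu_ge0 i : 0 <= mu i by rewrite muE divr_ge0.
have sum_mu (V : {set 'I_n}) : V \subset remaining z p ->
    \sum_(i in V) mu i = #|V|%:R / N%:R.
  move=> VU; rewrite -sum1_card natr_sum mulr_suml; apply: eq_bigr => i iV.
  by rewrite muE cardU (fintype.subsetP VU).
have mu1 : \sum_i mu i <= 1.
  rewrite (bigID (mem (remaining z p))) /= sum_mu// cardU divff ?gt_eqF//.
  by rewrite big1 ?addr0// => i /negPf iU; rewrite muE iU mul0r.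
pose bad := [pred S : {set 'I_n} | decode_block p S != Some (z p)].
(* A bad set either avoids the block or contains an index of mass 0, and in the second case it has
   probability 0. *)
have wor_bad : \sum_(S | bad S) wor_law mu k S <= 8^-1.
  apply: le_trans miss.
  rewrite -(card_block z)// -sum_mu ?block_sub//.
  apply: le_trans (wor_law_avoid _ mu_ge0 (block z p) k mu1).
  rewrite [leRHS]big_mkcond [leLHS]big_mkcond; apply: ler_sum => S _.
  case: ifPn => badS; last by case: ifP => // _; exact: wor_law_ge0.
  case: ifPn => // meets.
  have /subsetPn[i iS iU] : ~~ (S \subset remaining z p).
    by apply: contra badS => SU; rewrite (@decodeP z).
  by rewrite (@wor_law_support _ _ mu k S i)// muE (negPf iU) mul0r.
move=> tv.
(* The algorithm fails with probability at most 1/8 + 2/3 = 19/24, and 5/24 exceeds 1/6. *)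
have bad_le := sum_le_tv_dist R _ (output_law B P sigma) (wor_law mu k) bad.
have mX S := measurable_alg_output B sigma S.
have total : \sum_S output_law B P sigma S = 1.
  rewrite -[LHS](probability_fibers P _ _ predT mX) /=.
  by rewrite (_ : [set w | _]%classic = setT) ?probability_setT//; apply/seteqP.
rewrite (probability_fibers P _ _ (fun S => decode_block p S == Some (z p)) mX).
move: total; rewrite (bigID bad) /= => total.
rewrite (eq_bigl (fun S => ~~ bad S)) => [|S]; last by rewrite negbK.
rewrite -/(output_law B P sigma) in total *.
lra.
Qed.

End HardInstance.

(* Weakens Markov's inequality to one linear in [c], which can be summed. *)
Lemma truncated_expn (Q T D c : nat) : (0 < Q)%N -> (c <= D)%N ->
  (c * Q ^ T <= D * Q ^ c + T * Q ^ T)%N.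
Proof.
move=> Q_gt0 cD; have [cT|Tc] := leqP c T.
  by rewrite (leq_trans _ (leq_addl _ _))// leq_mul2r cT orbT.
rewrite (leq_trans _ (leq_addr _ _))// leq_mul// leq_pexp2l//.
exact: ltnW.
Qed.

(** * From decoding to a bound on the memory *)

Section MemoryBound.
Set Implicit Arguments.
Unset Strict Implicit.
Variables (R : realType) (d : measure_display) (T : measurableType d).
Variables (P : probability T R) (q : R) (D L n M k s : nat) (A : finType).
Variables (f : 'I_D * 'I_L * A -> 'I_n) (h : nat -> nat) (a0 : A).
Variable B : stream_alg T n s.
Hypothesis f_inj : injective f.
Hypothesis h_le : forall p, (p < D)%N -> (h p <= L)%N.
Hypothesis q_gt0 : 0 < q.
Hypothesis M_gt0 : (0 < M)%N.
Hypothesis B_samples : samples_wor P q M k B.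
Hypothesis D_gt0 : (0 < D)%N.
Hypothesis k_gt0 : (0 < k)%N.
Hypothesis k_le : forall p, (p < D)%N -> (k <= \sum_(i < p.+1) h i)%N.
Hypothesis miss : forall p, (p < D)%N ->
  (1 - (h p)%:R / (\sum_(i < p.+1) h i)%:R) ^+ k <= 8^-1 :> R.

(** Bob resumes at position [size (cells D L h)], the length of Alice's part for every word. As
    [later] starts at position [p.+1], indices are shifted; the junk values at positions up to [p]
    are never read by [deleted]. *)
Definition predict (w : T) (b : s.-tuple bool) (p : nat) (later : seq A) : option A :=
  decode_block f p (alg_out B w (alg_run B w (size (cells D L h)) b
    [seq (y, - 1) | y <- deleted f h (fun p' => nth a0 later (p' - p.+1)) p])).

Definition memory (w : T) (z : seq A) : s.-tuple bool :=
  alg_run B w 0 (alg_init B w) [seq (x, 1) | x <- inserted f h (nth a0 z)].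

(* The prediction sees only the letters after [p], although the decoder runs on
   a stream built from the whole word: Bob deletes only blocks after [p]. *)
Lemma decode_predict w (z : seq A) p :
  decode_block f p (alg_output B w (instance f h (nth a0 z) p)) =
  predict w (memory w z) p (drop p.+1 z).
Proof.
rewrite /alg_output /instance /signed_stream alg_run_cat !size_map add0n.
rewrite /predict; congr (decode_block f p (alg_out B w (alg_run B w _ _ _))).
congr (map _ _); apply/eq_in_map => x; rewrite mem_filter => /andP[px _].
by rewrite /coordinate nth_drop subnKC.
Qed.

(** More than [D / 6] letters are decoded on average; the truncation threshold [D %/ 12] gives up at
    most half of them. *)
Lemma memory_bound : (#|A| ^ (D %/ 12) <= 12 * 2 ^ s * 2 ^ D)%N.
Proof.
have A_gt0 : (0 < #|A|)%N by apply/card_gt0P; exists a0.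
pose E (x : D.-tuple A * 'I_D) := [set w | decode_block f x.2
  (alg_output B w (instance f h (nth a0 x.1) x.2)) == Some (nth a0 x.1 x.2)]%classic.
have mE x : measurable (E x).
  apply: (measurable_fiber_comp _ _
    (fun w => alg_output B w (instance f h (nth a0 x.1) x.2))
    (fun _ S => decode_block f x.2 S == Some (nth a0 x.1 x.2))).
    by move=> S; exact: measurable_alg_output.
  move=> S b; move: (_ == Some _) => correct.
  have [<-|ne] := eqVneq correct b.
    by rewrite (_ : [set _ | _]%classic = setT)//; apply/seteqP.
  rewrite (_ : [set _ | _]%classic = set0)//; apply/seteqP; split=> // t /= cb.
  by rewrite cb eqxx in ne.
have card_gt0 : (0 < #|{: D.-tuple A * 'I_D}|)%N.
  by rewrite card_prod card_tuple card_ord muln_gt0 expn_gt0 A_gt0.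
have [|w] := @exists_gt_average R d T P _ E (#|{: D.-tuple A * 'I_D}|%:R / 6) mE.
  rewrite (_ : _ / 6 = \sum_(x : D.-tuple A * 'I_D) 6^-1); last first.
    by rewrite sumr_const mulr_natl.
  have [x0 _] := card_gt0P card_gt0.
  apply: ltr_sum => [|x _]; first by apply/hasP; exists x0; rewrite ?mem_index_enum.
  apply: (decode_success f_inj h_le (nth a0 x.1) q_gt0 M_gt0 B_samples) => //.
  - exact: k_le.
  - exact: miss.
pose c (z : D.-tuple A) :=
  (\sum_(p < D) (predict w (memory w z) p (drop p.+1 z) == Some (nth a0 z p)))%N.
rewrite (_ : \sum_x _ = (\sum_z c z)%:R :> R); last first.
  rewrite natr_sum; under [RHS]eq_bigr do rewrite natr_sum.
  rewrite pair_bigA /=; apply: eq_bigr => x _; rewrite indicE; congr (_%:R).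
  by rewrite -decode_predict; congr nat_of_bool; apply/asboolP/idP.
rewrite ltr_pdivrMr// -natrM ltr_nat card_prod card_tuple card_ord => many.
(* The actual memory depends on [z]; summing over all contents [b] gives predictors that do not. *)
have few : (\sum_z #|A| ^ c z <= 2 ^ s * (2 * #|A|) ^ D)%N.
  apply: (@leq_trans (\sum_(z : D.-tuple A) \sum_(b : s.-tuple bool) #|A| ^
      (\sum_(p < D) (predict w b p (drop p.+1 z) == Some (nth a0 z p))))%N).
    apply: leq_sum => z _.
    by rewrite (bigD1 (memory w z))//= leq_addr.
  rewrite exchange_big /= (leq_trans (leq_sum _ (fun b _ =>
    sum_correct_predictions A a0 D (predict w b))))//.
  by rewrite sum_nat_const card_tuple card_bool.
have c_le z : (c z <= D)%N.
  apply: (@leq_trans (\sum_(p < D) 1)%N); last by rewrite sum1_card card_ord.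
  by apply: leq_sum => p _; exact: leq_b1.
set t := (D %/ 12)%N.
have key : ((\sum_z c z) * #|A| ^ t <=
    D * (2 ^ s * (2 * #|A|) ^ D) + t * #|A| ^ t * #|A| ^ D)%N.
  apply: (@leq_trans (\sum_(z : D.-tuple A) (D * #|A| ^ c z + t * #|A| ^ t))%N).
    by rewrite big_distrl; apply: leq_sum => z _; exact: truncated_expn.
  rewrite big_split /= -big_distrr /= sum_nat_const card_tuple.
  by rewrite [X in (_ + X <= _)%N]mulnC leq_add2r leq_mul2l few orbT.
have tD : (t * 12 <= D)%N by exact: leq_divM.
rewrite expnMn in key.
have AD_gt0 : (0 < #|A| ^ D)%N by rewrite expn_gt0 A_gt0.
have At_gt0 : (0 < #|A| ^ t)%N by rewrite expn_gt0 A_gt0.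
move: key many AD_gt0 At_gt0.
move: (\sum_z c z)%N (#|A| ^ D)%N (#|A| ^ t)%N (2 ^ s)%N (2 ^ D)%N => W X Y S U.
move=> key many X_gt0 Y_gt0.
rewrite -(@leq_pmul2l (D * X))%N ?muln_gt0 ?D_gt0//.
have h1 : (X * D * Y <= W * 6 * Y)%N by rewrite leq_mul2r ltnW ?orbT.
have h2 : (t * 12 * (Y * X) <= D * (Y * X))%N by rewrite leq_mul2r tD orbT.
have e1 : (W * 6 * Y * 2 = 12 * (W * Y))%N by lia.
nia.
Qed.

End MemoryBound.

(** * Block lengths growing geometrically *)

Section GeometricWeights.
Set Implicit Arguments.
Unset Strict Implicit.
Variables m k : nat.
Hypotheses (m_gt0 : (0 < m)%N) (k_gt0 : (0 < k)%N).

(** The factor [k] lets the first block alone supply a support of size [k]. *)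
Definition weight (p : nat) : nat := (k * 8 ^ (p %/ m))%N.

Lemma sum_weight_ge p : (k <= \sum_(i < p.+1) weight i)%N.
Proof. by rewrite big_ord_recl /weight div0n expn0 muln1 leq_addr. Qed.

Lemma sum_weight_levels j : (7 * \sum_(i < j * m) weight i <= m * k * 8 ^ j)%N.
Proof.
elim: j => [|j IHj]; first by rewrite big_ord0.
rewrite -(big_mkord predT) (big_cat_nat (n := (j * m)%N)) ?leq_mul2r ?leqnSn ?orbT//=.
rewrite big_mkord.
have -> : (\sum_(j * m <= i < j.+1 * m) weight i = m * k * 8 ^ j)%N.
  rewrite -{1}[(j * m)%N]add0n big_addn mulSn addnK.
  rewrite (eq_big_nat _ _ (F2 := fun=> (k * 8 ^ j)%N)) => [|i /andP[_ im]].
    by rewrite sum_nat_const_nat subn0 mulnA.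
  by rewrite /weight divnDMl// divn_small.
by rewrite expnS; move: IHj; lia.
Qed.

(** Complete the level of [p] to all its [m] positions and apply the geometric series bound. *)
Lemma sum_weight_le p : (7 * \sum_(i < p.+1) weight i <= 8 * m * weight p)%N.
Proof.
apply: (@leq_trans (7 * \sum_(i < (p %/ m).+1 * m) weight i)); last first.
  by rewrite (leq_trans (sum_weight_levels _))// expnS /weight; lia.
rewrite leq_mul2l /= -!(big_mkord predT) [leqRHS](@big_cat_nat _ _ _ p.+1) ?leq_addr//=.
exact: ltn_ceil.
Qed.

Variable R : realType.

Lemma bernoulli_ge (x : R) (j : nat) : 0 <= x -> 1 + j%:R * x <= (1 + x) ^+ j.
Proof.
move=> x_ge0; elim: j => [|j IHj]; first by rewrite mul0r addr0 expr0.
rewrite exprS (le_trans _ (ler_wpM2l _ IHj)) ?addr_ge0//.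
have : 0 <= j%:R * x * x by rewrite !mulr_ge0.
by rewrite -natr1; lra.
Qed.

(** With [q = 7 / (8 * m)], one draw suffices if [m = 1]. Otherwise [k * q >= 7], so Bernoulli gives
    [(1 + q) ^+ k >= 8], while [(1 - q) * (1 + q) <= 1]. *)
Lemma weight_miss p : m = 1%N \/ (8 * m <= k)%N ->
  (1 - (weight p)%:R / (\sum_(i < p.+1) weight i)%:R) ^+ k <= 8^-1 :> R.
Proof.
move=> mk; set w := weight p; set N := (\sum_(i < p.+1) weight i)%N.
have N_gt0 : (0 : R) < N%:R by rewrite ltr0n (leq_trans k_gt0)// sum_weight_ge.
have m_gt0R : (0 : R) < m%:R by rewrite ltr0n.
have wN : (w <= N)%N by rewrite /N big_ord_recr leq_addl.
set q : R := 7 / (8 * m%:R).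
have q_le : q <= w%:R / N%:R.
  rewrite /q ler_pdivrMr ?mulr_gt0// mulrAC ler_pdivlMr//.
  by rewrite mulrC -!natrM ler_nat mulnC (leq_trans (sum_weight_le p))// mulnC.
have q_ge0 : 0 <= q by rewrite divr_ge0// mulr_ge0.
have q_le1 : q <= 1.
  by rewrite (le_trans q_le)// ler_pdivrMr// mul1r ler_nat.
apply: (@le_trans _ _ ((1 - q) ^+ k)).
  by rewrite lerXn2r ?nnegrE ?subr_ge0 ?lerD2l ?lerN2// ler_pdivrMr// mul1r ler_nat.
case: mk => [m1|mk].
  have -> : 1 - q = 8^-1 by rewrite /q m1; lra.
  by rewrite -[leRHS]expr1 ler_wiXn2l//; lra.
have kq : 7 <= k%:R * q.
  rewrite /q mulrA ler_pdivlMr ?mulr_gt0// mulrC ler_wpM2r//.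
  by rewrite -natrM ler_nat.
have pow_ge : 8 <= (1 + q) ^+ k.
  by have := bernoulli_ge k q_ge0; lra.
have pow_gt0 : 0 < (1 + q) ^+ k by apply: lt_le_trans pow_ge.
rewrite -(ler_pM2r pow_gt0) -exprMn.
apply: (@le_trans _ _ 1).
  have qq_ge0 : 0 <= q * q by rewrite mulr_ge0.
  apply: exprn_ile1; last by nra.
  by apply: mulr_ge0; [rewrite subr_ge0|rewrite addr_ge0].
by rewrite mulrC ler_pdivlMr// mul1r.
Qed.

End GeometricWeights.

(** * Choice of the parameters *)

Lemma samples_wor_memory (R : realType) (d : measure_display)
    (T : measurableType d) (P : probability T R) (q : R) (n M m k s e : nat)
    (B : stream_alg T n s) :
  0 < q -> (0 < M)%N -> samples_wor P q M k B ->
  (0 < m <= k)%N -> (k <= 16 * m)%N -> m = 1%N \/ (8 * m <= k)%N ->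
  (100 <= e)%N -> (k <= 2 ^ e)%N -> (2 ^ (7 * e) <= n)%N ->
  (k * e ^ 2 <= 384 * s)%N.
Proof.
move=> q_gt0 M_gt0 BP /andP[m_gt0 mk] k16m mk8 e_ge ke n_ge.
have k_gt0 : (0 < k)%N by exact: leq_trans mk.
have Q_gt0 : (0 < 2 ^ e)%N by rewrite expn_gt0.
set D := (m * e)%N; set L := (k * 8 ^ e)%N.
have card_le : (#|{: 'I_D * 'I_L * 'I_(2 ^ e)}| <= n)%N.
  rewrite !card_prod !card_ord (leq_trans _ n_ge)// /D /L.
  (* The summands are the exponents bounding [m], [e], [k], [8 ^ e] and the alphabet size. *)
  have -> : (7 * e = e + e + (e + (3 * e)) + e)%N by lia.
  rewrite [in leqRHS]expnD [in leqRHS]expnD [in leqRHS]expnD [in leqRHS]expnD.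
  rewrite (expnM 2 3); apply: leq_mul => //; apply: leq_mul.
    by apply: leq_mul; [exact: leq_trans ke|exact/ltnW/ltn_expl].
  by apply: leq_mul.
pose f x := widen_ord card_le (enum_rank x).
have f_inj : injective f by move=> x y [] /val_inj /enum_rank_inj.
have h_le p : (p < D)%N -> (weight m k p <= L)%N.
  by move=> pD; rewrite leq_mul2l leq_exp2l// ltnW ?orbT// ltn_divLR// mulnC.
have D_gt0 : (0 < D)%N by rewrite muln_gt0 m_gt0 (leq_trans _ e_ge).
have := memory_bound (Ordinal Q_gt0) f_inj h_le q_gt0 M_gt0 BP D_gt0 k_gt0
  (fun p _ => sum_weight_ge m k p) (fun p _ => weight_miss m_gt0 k_gt0 R p mk8).
rewrite card_ord -expnM => le_pow.
have {le_pow} : (2 ^ (e * (D %/ 12)) <= 2 ^ (4 + s + D))%N.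
  rewrite (leq_trans le_pow)// expnD leq_mul2r; apply/orP; right.
  by rewrite expnD leq_mul2r orbT.
rewrite leq_exp2l// => le_exp.
have D12 : (D <= D %/ 12 * 12 + 11)%N.
  by rewrite {1}(divn_eq D 12) leq_add2l -ltnS ltn_pmod.
move: D12 le_exp; rewrite /D; move: (_ %/ 12)%N => t D12 le_exp.
have h1 : (e * (m * e) <= e * (t * 12 + 11))%N by rewrite leq_mul2l D12 orbT.
have h2 : (100 * (m * e) <= e * (m * e))%N by rewrite leq_mul2r e_ge orbT.
have h3 : (e <= m * e)%N by rewrite leq_pmull.
have h4 : (k * e ^ 2 <= 16 * (e * (m * e)))%N.
  have -> : (16 * (e * (m * e)) = 16 * m * e ^ 2)%N by rewrite -mulnn; lia.
  by rewrite leq_mul2r k16m orbT.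
(* Since [e >= 100], the error terms take at most half of [e * D], so [24 * s >= m * e ^ 2]; then
   [k <= 16 * m] gives 384 = 16 * 24. *)
move: h1 h2 h3 h4 le_exp; rewrite mulnDr mulnA; lia.
Qed.

Theorem theoremF2 (R : realType) :
  exists2 C0 : R, 0 < C0 &
    forall p : R, 0 < p <= 2 ->
    forall a : nat,
    exists2 c : R, 0 < c &
    exists n0 : nat,
    forall n M k s : nat,
      (n0 <= n)%N ->
      (0 < M <= n ^ a)%N ->
      k%:R < n%:R `^ C0 ->
    forall (d : measure_display) (T : measurableType d) (P : probability T R)
           (A : stream_alg T n s),
      samples_wor P p M k A ->
      c * k%:R * ln n%:R ^+ 2 <= s%:R.
Proof.
(* With [n < 2 ^ (16 * e)], this exponent yields [k <= 2 ^ e]. *)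
exists 16^-1 => [|p /andP[p_gt0 _] a]; first by rewrite invr_gt0.
(* The factor 256 is the square of 16 in [ln n <= 16 * e]. *)
exists (384 * 256)^-1; first by rewrite invr_gt0 mulr_gt0.
have [n0 n0P] : exists n0, forall n, (n0 <= n)%N ->
    (0 < n)%N /\ (100 <= trunc_log 2 n %/ 8)%N.
  move: 100%N => e0; exists (2 ^ (e0 * 8))%N => n n_ge; split.
    by rewrite (leq_trans _ n_ge)// expn_gt0.
  by rewrite leq_divRL// trunc_log_max.
exists n0 => n M k s /n0P[n_gt0 e_ge] /andP[M_gt0 _] k_lt d T P A AP.
(* Dividing by 8 leaves room for the [2 ^ (7 * e)] coordinates. *)
set e := (trunc_log 2 n %/ 8)%N in e_ge.
have log_lt : (trunc_log 2 n < (e + 1) * 8)%N by rewrite addn1 ltn_ceil.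
have log_le : ((trunc_log 2 n).+1 <= 16 * e)%N by lia.
have n_lt : (n < 2 ^ (16 * e))%N.
  by rewrite (leq_trans (trunc_log_ltn n (isT : 1 < 2)%N))// leq_exp2l.
have n_ge : (2 ^ (7 * e) <= n)%N.
  apply: leq_trans (trunc_logP (isT : 1 < 2)%N n_gt0); rewrite leq_exp2l//.
  by have := leq_divM (trunc_log 2 n) 8; rewrite -/e; lia.
have [->|k_neq0] := eqVneq k 0%N; first by rewrite mulr0 mul0r.
have k_gt0 : (0 < k)%N by rewrite lt0n.
have k_le : (k <= 2 ^ e)%N.
  have : (k%:R : R) ^+ 16 < n%:R.
    have -> : n%:R = (n%:R `^ 16^-1) ^+ 16 :> R.
      by rewrite -powR_mulrn ?powR_ge0// -powRrM mulVf ?pnatr_eq0// powRr1.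
    by rewrite ltr_pXn2r ?nnegrE ?powR_ge0.
  rewrite -natrX ltr_nat => /ltn_trans/(_ n_lt); rewrite mulnC expnM.
  by rewrite ltn_exp2r// => /ltnW.
(* For [k < 8] this is 1; otherwise [8 * m <= k < 8 * (m + 1) <= 16 * m]. *)
set m := maxn 1 (k %/ 8).
have memory : (k * e ^ 2 <= 384 * s)%N.
  have k8 := leq_divM k 8; have k8' := ltn_ceil k (isT : (0 < 8)%N).
  apply: (@samples_wor_memory R d T P p n M m k s e A) => //; rewrite /m; lia.
have ln_le : ln n%:R <= 16 * e%:R :> R.
  apply: (@le_trans _ _ (ln (2 ^+ (16 * e)))).
    by rewrite ler_ln ?posrE ?ltr0n ?exprn_gt0// -natrX ler_nat ltnW.
  rewrite lnXn// -[leLHS]mulr_natr natrM ler_piMl//.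
  by have := @le_ln1Dx R 1; rewrite -natr1; apply; lra.
have ln_ge0 : 0 <= ln n%:R :> R by rewrite ln_ge0// ler1n.
have sq_le : ln n%:R ^+ 2 <= 256 * e%:R ^+ 2 :> R.
  have -> : 256 * e%:R ^+ 2 = (16 * e%:R) ^+ 2 :> R by rewrite exprMn; lra.
  by rewrite lerXn2r// nnegrE// (le_trans ln_ge0).
have : k%:R * e%:R ^+ 2 <= 384 * s%:R :> R by rewrite -natrX -!natrM ler_nat.
have : k%:R * ln n%:R ^+ 2 <= k%:R * (256 * e%:R ^+ 2) :> R by rewrite ler_wpM2l.
rewrite -mulrA; lra.
Qed.
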